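(* Let $F$ be a field, let $m$ be a natural number and let $\mathbf{m}=m^\infty$. Then $L_F(1,m)_0\cong\operatorname{M}_{\mathbf{m}}(F)$.
   Context: The Leavitt algebra $L_F(1,m)$ of the $m$-petal is the unital $F$-algebra with generators $x_0,\dots,x_{m-1},y_0,\dots,y_{m-1}$ and relations $y_ix_j=\delta_{ij}$ for all $i,j$ and $\sum_i x_iy_i=1$. It is $\mathbb{Z}$-graded by $\deg(x_i)=-\deg(y_i)=1$, and $L_F(1,m)_0$ is its homogeneous component of degree zero. $\operatorname{M}_{\mathbf{m}}(F)=\varinjlim_t\operatorname{M}_{m^t}(F)$ is the direct limit along the diagonal embeddings $x\mapsto x\otimes 1=\operatorname{diag}(x,\dots,x)$. *)

(* Defs.v *)
From HB Require Import structures.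
From mathcomp Require Import all_boot all_algebra.
From mathcomp Require Import finmap boolp mxtens monalg.

Set Implicit Arguments.
Unset Strict Implicit.
Unset Printing Implicit Defensive.

Import GRing.Theory.
Local Open Scope ring_scope.
Local Open Scope quotient_scope.

Section FreeAlgebra.
Variables (R : comNzRingType) (I : choiceType).

(* The free unital associative R-algebra on I. *)
Definition free_alg : Type := {malg R[{fmonom I}]}.

HB.instance Definition _ := GRing.Lalgebra.on free_alg.

Definition free_gen (i : I) : free_alg := << fmu i >>.

Lemma malg_scalerAr (k : R) (u v : {malg R[{fmonom I}]}) :
  k *: (u * v) = u * (k *: v).
Proof.
have comm : k%:MP * u = u * k%:MP.
  rewrite !malgM_def fgmulUg fgmulgU; apply: eq_bigr => w _.
  by rewrite mul1m mulm1 mulrC.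
rewrite -(mul_malgC k (u * v)) (mulrA k%:MP u v) comm -(mulrA u _ v).
rewrite (mul_malgC k v); reflexivity.
Qed.
HB.instance Definition _ :=
  GRing.Lalgebra_isAlgebra.Build R free_alg malg_scalerAr.

End FreeAlgebra.

(* The quotient A / (S) may be trivial, as may 'M_0, so the algebra structures
   below are a pzRingType and an lmodType on the same carrier together with
   lemmas stating that scaling commutes with products: [algType] has 1 != 0. *)
Section PresentedQuotient.
Variables (R : pzRingType) (A : algType R) (S : A -> Prop).

(* The two-sided ideal generated by S. *)
Inductive gen_ideal : A -> Prop :=
| gen_ideal0 : gen_ideal 0
| gen_idealS a of S a : gen_ideal a
| gen_idealB a b of gen_ideal a & gen_ideal b : gen_ideal (a - b)
| gen_idealMl a b of gen_ideal b : gen_ideal (a * b)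
| gen_idealMr a b of gen_ideal a : gen_ideal (a * b).

Definition gen_ideal_pred : {pred A} := fun a => `[< gen_ideal a >].

Lemma gen_idealP a : reflect (gen_ideal a) (a \in gen_ideal_pred).
Proof. exact: asboolP. Qed.

Lemma gen_ideal_zmod : zmod_closed gen_ideal_pred.
Proof.
split=> [|a b /gen_idealP Ia /gen_idealP Ib]; apply/gen_idealP.
  exact: gen_ideal0.
exact: gen_idealB.
Qed.
HB.instance Definition _ := GRing.isZmodClosed.Build A gen_ideal_pred gen_ideal_zmod.

Definition alg_quot : Type := Quotient.quot gen_ideal_pred.

HB.instance Definition _ := GRing.Zmodule.on alg_quot.

Definition qpi (a : A) : alg_quot := \pi_(Quotient.quot gen_ideal_pred) a.
Definition qrep (x : alg_quot) : A := repr (x : Quotient.quot gen_ideal_pred).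

Lemma qrepK x : qpi (qrep x) = x.
Proof. exact: reprK. Qed.

Lemma qpi_eq a b : qpi a = qpi b <-> gen_ideal (a - b).
Proof.
split=> [/eqP|Iab]; first by rewrite /qpi -Quotient.idealrBE => /gen_idealP.
by apply/eqP; rewrite /qpi -Quotient.idealrBE; apply/gen_idealP.
Qed.

Lemma qpiB : zmod_morphism qpi.
Proof. by move=> a b; rewrite /qpi (raddfB (\pi_(Quotient.quot gen_ideal_pred))). Qed.
HB.instance Definition _ := GRing.isZmodMorphism.Build A alg_quot qpi qpiB.

Definition qmul (x y : alg_quot) : alg_quot := qpi (qrep x * qrep y).
Definition qscale (k : R) (x : alg_quot) : alg_quot := qpi (k *: qrep x).

Lemma qpi_mul a b : qmul (qpi a) (qpi b) = qpi (a * b).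
Proof.
have Ia : gen_ideal (qrep (qpi a) - a) by apply/qpi_eq; rewrite qrepK.
have Ib : gen_ideal (qrep (qpi b) - b) by apply/qpi_eq; rewrite qrepK.
apply/qpi_eq; rewrite -[X in X - _](subrK (a * qrep (qpi b))) -mulrBl -addrA.
rewrite -mulrBr -[X in _ + X]opprK -[- (a * _)]sub0r.
apply: gen_idealB; first exact: gen_idealMr.
by apply: gen_idealB; [exact: gen_ideal0 | exact: gen_idealMl].
Qed.

Lemma qpi_scale k a : qscale k (qpi a) = qpi (k *: a).
Proof.
have Ia : gen_ideal (qrep (qpi a) - a) by apply/qpi_eq; rewrite qrepK.
apply/qpi_eq; rewrite -scalerBr -[qrep _ - _]mul1r scalerAl.
exact: gen_idealMl.
Qed.

Lemma qmulA : associative qmul.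
Proof.
by move=> x y z; rewrite -(qrepK x) -(qrepK y) -(qrepK z) !qpi_mul mulrA.
Qed.

Lemma qmul1 : left_id (qpi 1) qmul.
Proof. by move=> x; rewrite -(qrepK x) qpi_mul mul1r. Qed.

Lemma qmulr1 : right_id (qpi 1) qmul.
Proof. by move=> x; rewrite -(qrepK x) qpi_mul mulr1. Qed.

Lemma qmulDl : left_distributive qmul +%R.
Proof.
move=> x y z; rewrite -(qrepK x) -(qrepK y) -(qrepK z).
by rewrite -raddfD !qpi_mul -raddfD mulrDl.
Qed.

Lemma qmulDr : right_distributive qmul +%R.
Proof.
move=> x y z; rewrite -(qrepK x) -(qrepK y) -(qrepK z).
by rewrite -raddfD !qpi_mul -raddfD mulrDr.
Qed.

HB.instance Definition _ :=
  GRing.Zmodule_isPzRing.Build alg_quot qmulA qmul1 qmulr1 qmulDl qmulDr.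

Lemma qscaleA a b x : qscale a (qscale b x) = qscale (a * b) x.
Proof. by rewrite -(qrepK x) !qpi_scale scalerA. Qed.

Lemma qscale1 : left_id 1 qscale.
Proof. by move=> x; rewrite -(qrepK x) qpi_scale scale1r. Qed.

Lemma qscaleDr : right_distributive qscale +%R.
Proof.
move=> k x y; rewrite -(qrepK x) -(qrepK y).
by rewrite -raddfD !qpi_scale -raddfD scalerDr.
Qed.

Lemma qscaleDl x : {morph qscale^~ x : a b / a + b}.
Proof. by move=> a b; rewrite -(qrepK x) !qpi_scale -raddfD scalerDl. Qed.

HB.instance Definition _ :=
  GRing.Zmodule_isLmodule.Build R alg_quot qscaleA qscale1 qscaleDr qscaleDl.


Lemma qpiM : monoid_morphism qpi.
Proof. by split=> // a b; rewrite -qpi_mul. Qed.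
HB.instance Definition _ := GRing.isMonoidMorphism.Build A alg_quot qpi qpiM.

Lemma qpiZ : scalable qpi.
Proof. by move=> k a; rewrite -qpi_scale. Qed.
HB.instance Definition _ := GRing.isScalable.Build R A alg_quot *:%R qpi qpiZ.

Lemma qscaleAl (k : R) (x y : alg_quot) : k *: (x * y) = (k *: x) * y.
Proof.
by rewrite -(qrepK x) -(qrepK y) -rmorphM -!linearZ -rmorphM scalerAl.
Qed.

Lemma qscaleAr (k : R) (x y : alg_quot) : k *: (x * y) = x * (k *: y).
Proof.
by rewrite -(qrepK x) -(qrepK y) -rmorphM -!linearZ -rmorphM scalerAr.
Qed.

End PresentedQuotient.

Section Leavitt.
Variables (F : fieldType) (m : nat).

(* inl i is the generator x_i and inr i is the generator y_i. *)
Definition leavitt_word := {fmonom ('I_m + 'I_m)%type}.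
Definition leavitt_free := free_alg F ('I_m + 'I_m)%type.

Definition gen_x (i : 'I_m) : leavitt_free := free_gen F (inl i).
Definition gen_y (i : 'I_m) : leavitt_free := free_gen F (inr i).

Inductive leavitt_relator : leavitt_free -> Prop :=
| relator_yx i j : leavitt_relator (gen_y i * gen_x j - (i == j)%:R)
| relator_xy : leavitt_relator (\sum_i gen_x i * gen_y i - 1).

Definition leavitt : Type := alg_quot leavitt_relator.
HB.instance Definition _ := GRing.PzRing.on leavitt.
HB.instance Definition _ := GRing.Lmodule.on leavitt.

Definition leavitt_pi : leavitt_free -> leavitt := @qpi _ _ leavitt_relator.

Definition word_deg (w : leavitt_word) : int :=
  \sum_(g <- (w : seq _)) (if g is inl _ then 1 else - 1).

Definition homog (d : int) (p : leavitt_free) : Prop :=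
  forall w, w \in msupp p -> word_deg w = d.

(* The homogeneous component of degree d: the span of the words of degree d. *)
Definition leavitt_comp (d : int) : {pred leavitt} :=
  fun a => `[< exists2 p, homog d p & a = leavitt_pi p >].

Lemma word_deg1 : word_deg mone = 0.
Proof. by rewrite /word_deg fm1 big_nil. Qed.

Lemma word_degM (v w : leavitt_word) :
  word_deg (mmul v w) = word_deg v + word_deg w.
Proof. by rewrite /word_deg fmM big_cat. Qed.

Lemma homogB d p q : homog d p -> homog d q -> homog d (p - q).
Proof.
by move=> hp hq w /(fsubsetP (msuppB_le _ _)); rewrite in_fsetU => /orP[/hp|/hq].
Qed.

Lemma homogZ d k p : homog d p -> homog d (k *: p).
Proof. by move=> hp w /(fsubsetP (msuppZ_le _ _)) /hp. Qed.

Lemma homogM d e p q : homog d p -> homog e q -> homog (d + e) (p * q).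
Proof.
by move=> hp hq w /msuppM_le[u [v [/hp <- /hq <- ->]]]; rewrite word_degM.
Qed.

Lemma homog1 : homog 0 1.
Proof.
have e : msupp (1 : leavitt_free) = [fset mone]%fset by exact: msuppU1.
by move=> w; rewrite e in_fset1 => /eqP->; exact: word_deg1.
Qed.

Definition leavitt0_pred : {pred leavitt} := leavitt_comp 0.

Lemma leavitt0P a :
  reflect (exists2 p, homog 0 p & a = leavitt_pi p) (a \in leavitt0_pred).
Proof. exact: asboolP. Qed.

Lemma leavitt0_subring : subring_closed leavitt0_pred.
Proof.
split=> [|a b|a b]; first by apply/leavitt0P; exists 1 => //; exact: homog1.
- move=> /leavitt0P[p hp ->] /leavitt0P[q hq ->]; apply/leavitt0P.
  by exists (p - q); [exact: homogB | rewrite /leavitt_pi raddfB].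
- move=> /leavitt0P[p hp ->] /leavitt0P[q hq ->]; apply/leavitt0P.
  by exists (p * q); [rewrite -[0]addr0; exact: homogM | rewrite /leavitt_pi rmorphM].
Qed.
HB.instance Definition _ :=
  GRing.isSubringClosed.Build leavitt leavitt0_pred leavitt0_subring.

Lemma leavitt0_scaler : GRing.scaler_closed leavitt0_pred.
Proof.
move=> k a /leavitt0P[p hp ->]; apply/leavitt0P.
by exists (k *: p); [exact: homogZ | rewrite /leavitt_pi linearZ].
Qed.
HB.instance Definition _ :=
  GRing.isScaleClosed.Build F leavitt leavitt0_pred leavitt0_scaler.

Record leavitt0 := Leavitt0 {
  leavitt0_val : leavitt; _ : leavitt0_val \in leavitt0_pred }.
HB.instance Definition _ := [isSub for leavitt0_val].
HB.instance Definition _ := [Choice of leavitt0 by <:].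
HB.instance Definition _ := 
  GRing.SubChoice_isSubPzRing.Build leavitt leavitt0_pred leavitt0 leavitt0_subring.
HB.instance Definition _ := [SubZmodule_isSubLmodule of leavitt0 by <:].

End Leavitt.

Section MatrixLimit.
Variables (F : fieldType) (m : nat).

(* In the row-major Kronecker convention of mxtens,
   1 *t A = diag(A, ..., A) with m diagonal blocks. *)
Definition diag_emb t (A : 'M[F]_(m ^ t)) : 'M[F]_(m ^ t.+1) :=
  castmx (esym (expnS m t), esym (expnS m t)) ((1%:M : 'M_m) *t A).

Fixpoint diag_iter s n (A : 'M[F]_(m ^ s)) : 'M[F]_(m ^ (n + s)) :=
  if n is n'.+1 then diag_emb (diag_iter n' A) else A.

Definition transition s t (le_st : (s <= t)%N) (A : 'M[F]_(m ^ s)) :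
    'M[F]_(m ^ t) :=
  let e := congr1 (expn m) (subnK le_st) in
  castmx (e, e) (diag_iter (t - s) A).

Lemma castmxM n n' (e : n = n') (A B : 'M[F]_n) :
  castmx (e, e) (A *m B) = castmx (e, e) A *m castmx (e, e) B.
Proof. by case: n' / e. Qed.

Lemma castmx1 n n' (e : n = n') : castmx (e, e) (1%:M : 'M[F]_n) = 1%:M.
Proof. by case: n' / e. Qed.

Lemma diag_embD t : {morph @diag_emb t : A B / A + B}.
Proof.
move=> A B; apply/matrixP=> i j; rewrite [RHS]mxE !castmxE.
by case: (mxtens_indexP (cast_ord _ i)) => i1 i2;
  case: (mxtens_indexP (cast_ord _ j)) => j1 j2; rewrite !tensmxE [X in _ * X = _]mxE mulrDr.
Qed.

Lemma diag_embZ t k : {morph @diag_emb t : A / k *: A}.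
Proof.
move=> A; apply/matrixP=> i j; rewrite [RHS]mxE !castmxE.
by case: (mxtens_indexP (cast_ord _ i)) => i1 i2;
  case: (mxtens_indexP (cast_ord _ j)) => j1 j2; rewrite !tensmxE [X in _ * X = _]mxE mulrCA.
Qed.

Lemma diag_embM t : {morph @diag_emb t : A B / A *m B}.
Proof. by move=> A B; rewrite /diag_emb -castmxM tensmx_mul mulmx1. Qed.

Lemma tensmx1 n n' : (1%:M : 'M[F]_n) *t (1%:M : 'M[F]_n') = 1%:M.
Proof.
apply/matrixP=> i j.
case: (mxtens_indexP i) => i1 i2; case: (mxtens_indexP j) => j1 j2.
rewrite tensmxE !mxE (can_eq (@mxtens_indexK _ _)) xpair_eqE.
by case: eqP; case: eqP; rewrite ?mulr0 ?mul0r ?mulr1.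
Qed.

Lemma diag_emb1 t : @diag_emb t 1%:M = 1%:M.
Proof. by rewrite /diag_emb tensmx1 castmx1. Qed.

Lemma diag_iterD s n : {morph @diag_iter s n : A B / A + B}.
Proof. by elim: n => //= n IH A B; rewrite IH diag_embD. Qed.

Lemma diag_iterZ s n k : {morph @diag_iter s n : A / k *: A}.
Proof. by elim: n => //= n IH A; rewrite IH diag_embZ. Qed.

Lemma diag_iterM s n : {morph @diag_iter s n : A B / A *m B}.
Proof. by elim: n => //= n IH A B; rewrite IH diag_embM. Qed.

Lemma diag_iter1 s n : @diag_iter s n 1%:M = 1%:M.
Proof. by elim: n => //= n ->; rewrite diag_emb1. Qed.

Lemma transitionE s n (le_sn : (s <= n + s)%N) A :
  transition le_sn A = diag_iter n A.
Proof.
rewrite /transition; move: (subnK le_sn); rewrite addnK => e.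
by rewrite (eq_irrelevance e erefl) castmx_id.
Qed.

Lemma transition_id s (le_ss : (s <= s)%N) A : transition le_ss A = A.
Proof. exact: (@transitionE s 0). Qed.

Lemma transitionS s t (le_st : (s <= t)%N) (le_st1 : (s <= t.+1)%N) A :
  transition le_st1 A = diag_emb (transition le_st A).
Proof.
move: (t - s)%N (subnK le_st) => n e; case: t / e in le_st le_st1 *.
by rewrite (@transitionE s n.+1) transitionE.
Qed.

Lemma transition_comp s t u (le_st : (s <= t)%N) (le_tu : (t <= u)%N)
    (le_su : (s <= u)%N) A :
  transition le_tu (transition le_st A) = transition le_su A.
Proof.
move: (u - t)%N (subnK le_tu) => n e; case: u / e in le_tu le_su *.
elim: n le_tu le_su => [|n IH] le1 le2.
  by rewrite transition_id (bool_irrelevance le2 le_st).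
have le1' : (t <= n + t)%N by exact: leq_addl.
have le2' : (s <= n + t)%N by exact: leq_trans le1'.
by rewrite (transitionS le1') (transitionS le2') IH.
Qed.

Lemma transitionD s t (le_st : (s <= t)%N) : {morph transition le_st : A B / A + B}.
Proof.
move: (t - s)%N (subnK le_st) => n e; case: t / e in le_st *.
by move=> A B; rewrite !transitionE diag_iterD.
Qed.

Lemma transitionZ s t (le_st : (s <= t)%N) k : {morph transition le_st : A / k *: A}.
Proof.
move: (t - s)%N (subnK le_st) => n e; case: t / e in le_st *.
by move=> A; rewrite !transitionE diag_iterZ.
Qed.

Lemma transitionM s t (le_st : (s <= t)%N) : {morph transition le_st : A B / A *m B}.
Proof.
move: (t - s)%N (subnK le_st) => n e; case: t / e in le_st *.
by move=> A B; rewrite !transitionE diag_iterM.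
Qed.

Lemma transition1 s t (le_st : (s <= t)%N) : transition le_st 1%:M = 1%:M.
Proof.
move: (t - s)%N (subnK le_st) => n e; case: t / e in le_st *.
by rewrite !transitionE diag_iter1.
Qed.

(* The direct limit is the disjoint union of the 'M_(m ^ t), modulo becoming
   equal at a later stage. *)
Definition staged := {t : nat & 'M[F]_(m ^ t)}.

Definition limit_equiv (x y : staged) : bool :=
  `[< exists u (le_xu : (tag x <= u)%N) (le_yu : (tag y <= u)%N),
        transition le_xu (tagged x) = transition le_yu (tagged y) >].

Lemma limit_equiv_refl : reflexive limit_equiv.
Proof. by move=> x; apply/asboolP; exists (tag x), (leqnn _), (leqnn _). Qed.

Lemma limit_equiv_sym : symmetric limit_equiv.
Proof.
by move=> x y; apply/asboolP/asboolP => -[u [hx [hy e]]]; exists u, hy, hx.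
Qed.

Lemma limit_equiv_trans : transitive limit_equiv.
Proof.
move=> y x z /asboolP[u [hx [hy e]]] /asboolP[v [hy' [hz e']]]; apply/asboolP.
have hu : (u <= maxn u v)%N by exact: leq_maxl.
have hv : (v <= maxn u v)%N by exact: leq_maxr.
have hyw := leq_trans hy hu.
exists (maxn u v), (leq_trans hx hu), (leq_trans hz hv).
rewrite -(transition_comp hx hu) e -(transition_comp hz hv) -e'.
by rewrite (transition_comp hy hu hyw) (transition_comp hy' hv hyw).
Qed.

Canonical limit_equiv_rel :=
  EquivRel limit_equiv limit_equiv_refl limit_equiv_sym limit_equiv_trans.

Definition matrix_limit : Type := {eq_quot limit_equiv}.
HB.instance Definition _ := Choice.on matrix_limit.

(* The canonical map 'M_(m ^ t) -> M_(m^oo). *)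
Definition limit_in t (A : 'M[F]_(m ^ t)) : matrix_limit :=
  \pi_{eq_quot limit_equiv} (Tagged (fun t => 'M[F]_(m ^ t)) A).

Lemma limit_in_eq s t (A : 'M[F]_(m ^ s)) (B : 'M[F]_(m ^ t)) :
  limit_in A = limit_in B <->
  exists u (hs : (s <= u)%N) (ht : (t <= u)%N), transition hs A = transition ht B.
Proof. by split=> [/eqmodP/asboolP|AB] //; apply/eqmodP/asboolP. Qed.

Lemma limit_in_transition s t (le_st : (s <= t)%N) A :
  limit_in (transition le_st A) = limit_in A.
Proof.
by apply/limit_in_eq; exists t, (leqnn t), le_st; rewrite transition_id.
Qed.

Definition limit_tag (x : matrix_limit) : nat :=
  tag (repr (x : {eq_quot limit_equiv})).
Definition limit_rep (x : matrix_limit) : 'M[F]_(m ^ limit_tag x) :=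
  tagged (repr (x : {eq_quot limit_equiv})).

Lemma limit_repK x : limit_in (limit_rep x) = x.
Proof.
rewrite /limit_in /limit_rep /limit_tag -[RHS]reprK; congr (\pi _).
by case: (repr _).
Qed.

Definition limit_op2 (op : forall t, 'M[F]_(m ^ t) -> 'M_(m ^ t) -> 'M_(m ^ t))
    (x y : matrix_limit) : matrix_limit :=
  limit_in (op _ (transition (leq_maxl _ (limit_tag y)) (limit_rep x))
                 (transition (leq_maxr (limit_tag x) _) (limit_rep y))).

Definition limit_op1 (op : forall t, 'M[F]_(m ^ t) -> 'M_(m ^ t))
    (x : matrix_limit) : matrix_limit := limit_in (op _ (limit_rep x)).

Lemma limit_op2E op :
    (forall s t (h : (s <= t)%N), {morph transition h : A B / op _ A B}) ->
  forall t (A B : 'M[F]_(m ^ t)),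
  limit_op2 op (limit_in A) (limit_in B) = limit_in (op t A B).
Proof.
move=> opE t A B; rewrite /limit_op2.
move: (limit_rep (limit_in A)) (limit_repK (limit_in A)).
move: (limit_rep (limit_in B)) (limit_repK (limit_in B)).
move: (limit_tag (limit_in A)) (limit_tag (limit_in B)) => a b B' eB A' eA.
have [u [ha [ht e1]]] := (limit_in_eq A' A).1 eA.
have [v [hb [ht' e2]]] := (limit_in_eq B' B).1 eB.
set w := maxn (maxn a b) (maxn u v).
have hu : (u <= w)%N by rewrite !leq_max leqnn !orbT.
have hv : (v <= w)%N by rewrite !leq_max leqnn !orbT.
have hab : (maxn a b <= w)%N by exact: leq_maxl.
have htw := leq_trans ht hu; have haw := leq_trans ha hu.
have hbw := leq_trans hb hv.
rewrite -(limit_in_transition hab) -[RHS](limit_in_transition htw) !opE.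
congr (limit_in (op _ _ _)).
  rewrite (transition_comp _ _ haw) -(transition_comp ha hu) e1.
  exact: transition_comp.
rewrite (transition_comp _ _ hbw) -(transition_comp hb hv) e2.
exact: transition_comp.
Qed.

Lemma limit_op1E op :
    (forall s t (h : (s <= t)%N), {morph transition h : A / op _ A}) ->
  forall t (A : 'M[F]_(m ^ t)), limit_op1 op (limit_in A) = limit_in (op t A).
Proof.
move=> opE t A; rewrite /limit_op1.
have [u [ha [ht e]]] := (limit_in_eq _ _).1 (limit_repK (limit_in A)).
by rewrite -(limit_in_transition ha) -[RHS](limit_in_transition ht) !opE e.
Qed.

Definition limit_add := limit_op2 (fun t => +%R).
Definition limit_opp := limit_op1 (fun t => -%R).
Definition limit_mul := limit_op2 (fun t => @mulmx F _ _ _).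
Definition limit_scale k := limit_op1 (fun t => *:%R k).

Lemma limit_addE t (A B : 'M[F]_(m ^ t)) :
  limit_add (limit_in A) (limit_in B) = limit_in (A + B).
Proof. by apply: limit_op2E => *; exact: transitionD. Qed.

Lemma limit_mulE t (A B : 'M[F]_(m ^ t)) :
  limit_mul (limit_in A) (limit_in B) = limit_in (A *m B).
Proof. by apply: limit_op2E => *; exact: transitionM. Qed.

Lemma limit_scaleE k t (A : 'M[F]_(m ^ t)) :
  limit_scale k (limit_in A) = limit_in (k *: A).
Proof. by apply: (@limit_op1E (fun t => *:%R k)) => *; exact: transitionZ. Qed.

Lemma limit_oppE t (A : 'M[F]_(m ^ t)) : limit_opp (limit_in A) = limit_in (- A).
Proof.
apply: (@limit_op1E (fun t => -%R)) => a b h B.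
by rewrite -!scaleN1r transitionZ.
Qed.

Lemma limit_in0 s t : limit_in (0 : 'M_(m ^ s)) = limit_in (0 : 'M_(m ^ t)).
Proof.
apply/limit_in_eq; exists (maxn s t), (leq_maxl _ _), (leq_maxr _ _).
by rewrite -(scale0r 0) transitionZ scale0r -[in RHS](scale0r 0) transitionZ scale0r.
Qed.

Lemma limit_in1 s t : limit_in (1%:M : 'M_(m ^ s)) = limit_in (1%:M : 'M_(m ^ t)).
Proof.
apply/limit_in_eq; exists (maxn s t), (leq_maxl _ _), (leq_maxr _ _).
by rewrite !transition1.
Qed.

Lemma limit_common2 (x y : matrix_limit) :
  exists t (A B : 'M[F]_(m ^ t)), x = limit_in A /\ y = limit_in B.
Proof.
exists (maxn (limit_tag x) (limit_tag y)), (transition (leq_maxl _ _) (limit_rep x)).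
exists (transition (leq_maxr _ _) (limit_rep y)).
by rewrite !limit_in_transition !limit_repK.
Qed.

Lemma limit_common3 (x y z : matrix_limit) :
  exists t (A B C : 'M[F]_(m ^ t)), [/\ x = limit_in A, y = limit_in B & z = limit_in C].
Proof.
have [t [A [B [-> ->]]]] := limit_common2 x y.
exists (maxn t (limit_tag z)), (transition (leq_maxl _ _) A).
exists (transition (leq_maxl _ _) B), (transition (leq_maxr _ _) (limit_rep z)).
by rewrite !limit_in_transition limit_repK.
Qed.

Definition limit0 := limit_in (0 : 'M[F]_(m ^ 0)).
Definition limit1 := limit_in (1%:M : 'M[F]_(m ^ 0)).

Lemma limit_addA : associative limit_add.
Proof.
move=> x y z; have [t [A [B [C [-> -> ->]]]]] := limit_common3 x y z.
by rewrite !limit_addE addrA.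
Qed.

Lemma limit_addC : commutative limit_add.
Proof.
move=> x y; have [t [A [B [-> ->]]]] := limit_common2 x y.
by rewrite !limit_addE addrC.
Qed.

Lemma limit_add0 : left_id limit0 limit_add.
Proof.
by move=> x; rewrite -(limit_repK x) /limit0 (limit_in0 0 (limit_tag x)) limit_addE add0r.
Qed.

Lemma limit_addN : left_inverse limit0 limit_opp limit_add.
Proof.
move=> x; rewrite -(limit_repK x) limit_oppE limit_addE addNr.
exact: limit_in0.
Qed.

HB.instance Definition _ :=
  GRing.isZmodule.Build matrix_limit limit_addA limit_addC limit_add0 limit_addN.

Lemma limit_inD t (A B : 'M[F]_(m ^ t)) :
  limit_in A + limit_in B = limit_in (A + B).
Proof. exact: limit_addE. Qed.

Lemma limit_mulA : associative limit_mul.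
Proof.
move=> x y z; have [t [A [B [C [-> -> ->]]]]] := limit_common3 x y z.
by rewrite !limit_mulE mulmxA.
Qed.

Lemma limit_mul1 : left_id limit1 limit_mul.
Proof.
by move=> x; rewrite -(limit_repK x) /limit1 (limit_in1 0 (limit_tag x)) limit_mulE mul1mx.
Qed.

Lemma limit_mulr1 : right_id limit1 limit_mul.
Proof.
by move=> x; rewrite -(limit_repK x) /limit1 (limit_in1 0 (limit_tag x)) limit_mulE mulmx1.
Qed.

Lemma limit_mulDl : left_distributive limit_mul +%R.
Proof.
move=> x y z; have [t [A [B [C [-> -> ->]]]]] := limit_common3 x y z.
by rewrite !(limit_mulE, limit_inD) mulmxDl.
Qed.

Lemma limit_mulDr : right_distributive limit_mul +%R.
Proof.
move=> x y z; have [t [A [B [C [-> -> ->]]]]] := limit_common3 x y z.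
by rewrite !(limit_mulE, limit_inD) mulmxDr.
Qed.

HB.instance Definition _ := GRing.Zmodule_isPzRing.Build matrix_limit
  limit_mulA limit_mul1 limit_mulr1 limit_mulDl limit_mulDr.

Lemma limit_scaleA a b x : limit_scale a (limit_scale b x) = limit_scale (a * b) x.
Proof. by rewrite -(limit_repK x) !limit_scaleE scalerA. Qed.

Lemma limit_scale1 : left_id 1 limit_scale.
Proof. by move=> x; rewrite -(limit_repK x) limit_scaleE scale1r. Qed.

Lemma limit_scaleDr : right_distributive limit_scale +%R.
Proof.
move=> k x y; have [t [A [B [-> ->]]]] := limit_common2 x y.
by rewrite !(limit_scaleE, limit_inD) scalerDr.
Qed.

Lemma limit_scaleDl x : {morph limit_scale^~ x : a b / a + b}.
Proof.
by move=> a b; rewrite -(limit_repK x) !(limit_scaleE, limit_inD) scalerDl.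
Qed.

HB.instance Definition _ := GRing.Zmodule_isLmodule.Build F matrix_limit
  limit_scaleA limit_scale1 limit_scaleDr limit_scaleDl.

Lemma limit_inM t (A B : 'M[F]_(m ^ t)) :
  limit_in A * limit_in B = limit_in (A *m B).
Proof. exact: limit_mulE. Qed.

Lemma limit_inZ k t (A : 'M[F]_(m ^ t)) : k *: limit_in A = limit_in (k *: A).
Proof. exact: limit_scaleE. Qed.

Lemma limit_in_one t : limit_in (1%:M : 'M[F]_(m ^ t)) = 1.
Proof. exact: limit_in1. Qed.

Lemma limit_scalerAl k (x y : matrix_limit) : k *: (x * y) = (k *: x) * y.
Proof.
have [t [A [B [-> ->]]]] := limit_common2 x y.
by rewrite !(limit_inM, limit_inZ) scalemxAl.
Qed.

Lemma limit_scalerAr k (x y : matrix_limit) : k *: (x * y) = x * (k *: y).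
Proof.
have [t [A [B [-> ->]]]] := limit_common2 x y.
by rewrite !(limit_inM, limit_inZ) scalemxAr.
Qed.

End MatrixLimit.

(* Main.v *)
(* For words i = i_1 ... i_t put X_i = x_(i_1) ... x_(i_t) and
   Y_i = y_(i_t) ... y_(i_1); then Y_i X_j = delta_ij and the sum of the X_i Y_i
   is 1, so A |-> \sum A i j X_i Y_j is an algebra morphism from matrices of
   size m ^ t to the Leavitt algebra, and the relation \sum x_k y_k = 1 makes
   these morphisms agree along the diagonal embeddings.  They are injective
   because Y_i a X_j recovers the (i, j) entry, once the Leavitt algebra is known
   to be nonzero: for m > 0 it acts on sequences nat -> F through the bijection
   n |-> (n %% m, n %/ m), and for m = 0 both algebras vanish.  They cover degree
   zero because a word w of degree zero maps the span of the X_i with |i| = n to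
   itself as soon as |w| <= n, whence w = \sum (w X_i) Y_i. *)

Require Import Defs.
From HB Require Import structures.
From mathcomp Require Import all_boot all_algebra.
From mathcomp Require Import finmap boolp mxtens monalg.

Set Implicit Arguments.
Unset Strict Implicit.
Unset Printing Implicit Defensive.

Import GRing.Theory.
Local Open Scope ring_scope.

(** * Indexing matrix entries by words in [m] letters *)

Section PowerIndex.
Variables (F : fieldType) (m : nat).

(** Indices below [m ^ t] stand for words of length [t]. The added letter [k] is the block number in
    the Kronecker product [1 *t A]. *)
Definition pow_index t (k : 'I_m) (i : 'I_(m ^ t)) : 'I_(m ^ t.+1) :=
  cast_ord (esym (expnS m t)) (mxtens_index (k, i)).

Definition pow_unindex t (i : 'I_(m ^ t.+1)) : 'I_m * 'I_(m ^ t) :=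
  mxtens_unindex (cast_ord (expnS m t) i).

Lemma pow_indexK t k (i : 'I_(m ^ t)) : pow_unindex (pow_index k i) = (k, i).
Proof. by rewrite /pow_unindex cast_ordKV mxtens_indexK. Qed.

Lemma pow_unindexK t (i : 'I_(m ^ t.+1)) :
  pow_index (pow_unindex i).1 (pow_unindex i).2 = i.
Proof. by rewrite /pow_index -surjective_pairing mxtens_unindexK cast_ordK. Qed.

Lemma eq_pow_index t k l (i j : 'I_(m ^ t)) :
  (pow_index k i == pow_index l j) = (k == l) && (i == j).
Proof.
have inj : injective (fun p => @pow_index t p.1 p.2).
  by apply: (can_inj (g := @pow_unindex t)) => -[k' i']; rewrite pow_indexK.
by rewrite -xpair_eqE -(inj_eq inj).
Qed.

Lemma big_pow_index (V : nmodType) t (G : 'I_(m ^ t.+1) -> V) :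
  \sum_i G i = \sum_k \sum_i G (pow_index k i).
Proof.
rewrite pair_bigA /=; apply: (reindex (fun p => @pow_index t p.1 p.2)).
exists (@pow_unindex t) => [[k i] _|i _]; first exact: pow_indexK.
exact: pow_unindexK.
Qed.

Lemma diag_embE t (A : 'M[F]_(m ^ t)) k l i j :
  diag_emb A (pow_index k i) (pow_index l j) = (k == l)%:R * A i j.
Proof. by rewrite castmxE !esymK !cast_ordKV tensmxE mxE. Qed.

End PowerIndex.

(** * Matrix algebras inside a ring with a Leavitt family *)

Section LeavittFamily.
(** Scalars enter through a central ring morphism [iota]: the Leavitt algebra may be zero, so no
    [algType] structure is assumed on [L]. *)
Variables (F : fieldType) (L : pzRingType) (iota : {rmorphism F -> L}) (m : nat).
Variables (x y : 'I_m -> L).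
Hypothesis iota_comm : forall c a, iota c * a = a * iota c.
Hypothesis yx : forall k l, y k * x l = (k == l)%:R.
Hypothesis xy : \sum_k x k * y k = 1.
Implicit Types (a b : L) (k l : 'I_m) (c : F) (s t n : nat).

(* The new letter is the innermost one: this is what makes [mx_leavitt] compatible
   with [A |-> diag(A, ..., A)] rather than with [A |-> A *t 1]. *)
Fixpoint xpath t : 'I_(m ^ t) -> L :=
  if t is t'.+1 then
    fun i => xpath (pow_unindex i).2 * x (pow_unindex i).1
  else fun=> 1.

Fixpoint ypath t : 'I_(m ^ t) -> L :=
  if t is t'.+1 then
    fun i => y (pow_unindex i).1 * ypath (pow_unindex i).2
  else fun=> 1.

Lemma xpathS t k (i : 'I_(m ^ t)) : xpath (pow_index k i) = xpath i * x k.
Proof. exact: (congr1 (fun p => xpath p.2 * x p.1) (pow_indexK k i)). Qed.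

Lemma ypathS t k (i : 'I_(m ^ t)) : ypath (pow_index k i) = y k * ypath i.
Proof. exact: (congr1 (fun p => y p.1 * ypath p.2) (pow_indexK k i)). Qed.

Arguments xpath : simpl never.
Arguments ypath : simpl never.

(** The reversed order of letters makes the product nest as [y_k (Y_i X_j) x_l]; by induction the
    inner factor is 0 or 1, which leaves [y_k x_l]. *)
Lemma ypath_xpath t (i j : 'I_(m ^ t)) : ypath i * xpath j = (i == j)%:R.
Proof.
elim: t i j => [|t IH] i j; first by rewrite mul1r [i]ord1 [j]ord1 eqxx.
rewrite -[i]pow_unindexK -[j]pow_unindexK xpathS ypathS eq_pow_index.
rewrite -mulrA (mulrA (ypath _)) IH.
case: eqP => _ /=; last by rewrite andbF mul0r mulr0.
by rewrite andbT mul1r yx.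
Qed.

Lemma sum_xpath_ypath t : \sum_(i < m ^ t) xpath i * ypath i = 1.
Proof.
elim: t => [|t IH]; first by rewrite big_ord1 mulr1.
rewrite big_pow_index exchange_big -[RHS]IH; apply: eq_bigr => i _ /=.
transitivity (xpath i * (\sum_k x k * y k) * ypath i).
  rewrite mulr_sumr mulr_suml; apply: eq_bigr => k _.
  by rewrite xpathS ypathS !mulrA.
by rewrite xy mulr1.
Qed.

Definition mx_leavitt t (A : 'M[F]_(m ^ t)) : L :=
  \sum_i \sum_j iota (A i j) * (xpath i * ypath j).

(** Only terms with equal innermost letters survive, and together they insert [\sum_k x k * y k = 1]
    between [xpath i] and [ypath j]. *)
Lemma mx_leavitt_diag_emb t (A : 'M_(m ^ t)) : mx_leavitt (diag_emb A) = mx_leavitt A.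
Proof.
rewrite /mx_leavitt big_pow_index exchange_big; apply: eq_bigr => i _ /=.
under eq_bigr => k _ do rewrite big_pow_index exchange_big.
rewrite exchange_big; apply: eq_bigr => j _ /=.
transitivity (iota (A i j) * (xpath i * (\sum_k x k * y k) * ypath j)); last first.
  by rewrite xy mulr1.
rewrite [xpath i * _]mulr_sumr mulr_suml mulr_sumr; apply: eq_bigr => k _.
rewrite (bigD1 k) //= big1 ?addr0 => [|l ne_lk].
  by rewrite diag_embE eqxx mul1r xpathS ypathS !mulrA.
by rewrite diag_embE eq_sym (negbTE ne_lk) mul0r rmorph0 mul0r.
Qed.

Lemma mx_leavitt_transition s t (le_st : (s <= t)%N) (A : 'M_(m ^ s)) :
  mx_leavitt (transition le_st A) = mx_leavitt A.
Proof.
move: (t - s)%N (subnK le_st) => n e; case: t / e in le_st *.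
by rewrite transitionE; elim: n {le_st} => //= n IH; rewrite mx_leavitt_diag_emb.
Qed.

Lemma mx_leavittD t : {morph @mx_leavitt t : A B / A + B}.
Proof.
move=> A B; rewrite /mx_leavitt -big_split /=; apply: eq_bigr => i _ /=.
by rewrite -big_split /=; apply: eq_bigr => j _; rewrite mxE rmorphD mulrDl.
Qed.

Lemma mx_leavittZ t c (A : 'M_(m ^ t)) : mx_leavitt (c *: A) = iota c * mx_leavitt A.
Proof.
rewrite /mx_leavitt mulr_sumr; apply: eq_bigr => i _ /=.
by rewrite mulr_sumr; apply: eq_bigr => j _; rewrite mxE rmorphM -mulrA.
Qed.

Lemma mx_leavitt1 t : mx_leavitt (1%:M : 'M_(m ^ t)) = 1.
Proof.
rewrite -(sum_xpath_ypath t); apply: eq_bigr => i _.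
rewrite (bigD1 i) //= big1 ?addr0 => [|j ne_ji]; rewrite mxE.
  by rewrite eqxx rmorph1 mul1r.
by rewrite eq_sym (negbTE ne_ji) rmorph0 mul0r.
Qed.

Lemma mx_leavitt_xpath t (A : 'M_(m ^ t)) j :
  mx_leavitt A * xpath j = \sum_i iota (A i j) * xpath i.
Proof.
rewrite mulr_suml; apply: eq_bigr => i _; rewrite mulr_suml.
rewrite (bigD1 j) //= big1 ?addr0 => [|l ne_lj]; rewrite -!mulrA ypath_xpath.
  by rewrite eqxx mulr1.
by rewrite (negbTE ne_lj) !mulr0.
Qed.

(** As the [X_j Y_j] sum to 1, an element is determined by its products with the [X_j]. This
    criterion serves both multiplicativity and surjectivity. *)
Lemma mx_leavitt_of_xpath t (A : 'M_(m ^ t)) a :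
  (forall j, a * xpath j = \sum_i iota (A i j) * xpath i) -> a = mx_leavitt A.
Proof.
move=> aE; rewrite -[a]mulr1 -(sum_xpath_ypath t) mulr_sumr.
rewrite /mx_leavitt exchange_big; apply: eq_bigr => j _ /=.
by rewrite mulrA aE mulr_suml; apply: eq_bigr => i _; rewrite mulrA.
Qed.

Lemma mx_leavittM t (A B : 'M_(m ^ t)) : mx_leavitt (A *m B) = mx_leavitt A * mx_leavitt B.
Proof.
apply/esym/mx_leavitt_of_xpath => j; rewrite -mulrA mx_leavitt_xpath mulr_sumr.
under eq_bigr => l _ do rewrite mulrA -iota_comm -mulrA mx_leavitt_xpath mulr_sumr.
rewrite exchange_big; apply: eq_bigr => i _ /=.
rewrite mxE rmorph_sum mulr_suml; apply: eq_bigr => l _.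
by rewrite rmorphM mulrA (iota_comm (A i l)).
Qed.

Lemma mx_leavitt_eq0 t (A : 'M_(m ^ t)) : (1 : L) <> 0 -> mx_leavitt A = 0 -> A = 0.
Proof.
move=> nz mx_leavittA0; apply/matrixP=> i j; rewrite mxE.
have e : iota (A i j) = 0.
  transitivity (ypath i * (mx_leavitt A * xpath j)); last first.
    by rewrite mx_leavittA0 mul0r mulr0.
  rewrite mx_leavitt_xpath mulr_sumr (bigD1 i) //= big1 ?addr0 => [|l ne_li];
    rewrite mulrA -iota_comm -mulrA ypath_xpath ?eqxx ?mulr1 //.
  by rewrite eq_sym (negbTE ne_li) mulr0.
(* A nonzero entry would be invertible, so the vanishing of its image under [iota] would force
   [1 = 0]. *)
apply: contra_notP nz => /eqP Aij.
by rewrite -(rmorph1 iota) -(mulVf Aij) rmorphM e mulr0.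
Qed.

(** * Passage to the direct limit *)

Definition limit_mx_leavitt (z : matrix_limit F m) : L := mx_leavitt (limit_rep z).

(** The chosen representative does not matter: it agrees with [A] at a later stage, and transitions
    leave [mx_leavitt] unchanged. *)
Lemma limit_mx_leavittE t (A : 'M_(m ^ t)) : limit_mx_leavitt (limit_in A) = mx_leavitt A.
Proof.
have [u [hs [ht e]]] := (limit_in_eq _ _).1 (limit_repK (limit_in A)).
by rewrite /limit_mx_leavitt -(mx_leavitt_transition hs) e mx_leavitt_transition.
Qed.

Lemma limit_mx_leavittD : {morph limit_mx_leavitt : z w / z + w}.
Proof.
move=> z w; have [t [A [B [-> ->]]]] := limit_common2 z w.
by rewrite limit_inD !limit_mx_leavittE mx_leavittD.
Qed.

Lemma limit_mx_leavittM : {morph limit_mx_leavitt : z w / z * w}.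
Proof.
move=> z w; have [t [A [B [-> ->]]]] := limit_common2 z w.
by rewrite limit_inM !limit_mx_leavittE mx_leavittM.
Qed.

Lemma limit_mx_leavittZ c z : limit_mx_leavitt (c *: z) = iota c * limit_mx_leavitt z.
Proof. by rewrite -(limit_repK z) limit_inZ !limit_mx_leavittE mx_leavittZ. Qed.

Lemma limit_mx_leavitt1 : limit_mx_leavitt 1 = 1.
Proof. by rewrite -(limit_in_one F m 0) limit_mx_leavittE mx_leavitt1. Qed.

Lemma limit_mx_leavitt_inj : (1 : L) <> 0 -> injective limit_mx_leavitt.
Proof.
move=> nz z w; have [t [A [B [-> ->]]]] := limit_common2 z w.
rewrite !limit_mx_leavittE => e; rewrite -[A](subrK B) (@mx_leavitt_eq0 _ (A - B)) ?add0r //.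
by rewrite mx_leavittD -scaleN1r mx_leavittZ rmorphN1 mulN1r e subrr.
Qed.

(** * Spans of the monomials [X_i] of a fixed length *)

Definition xspan n a := exists c : 'I_(m ^ n) -> F, a = \sum_i iota (c i) * xpath i.

Lemma xspan_xpath n (i : 'I_(m ^ n)) : xspan n (xpath i).
Proof.
exists (fun j => (j == i)%:R); rewrite (bigD1 i) //= big1 ?addr0 => [|j /negbTE->].
  by rewrite eqxx rmorph1 mul1r.
by rewrite rmorph0 mul0r.
Qed.

Lemma xspan0 n : xspan n 0.
Proof. by exists (fun=> 0); rewrite big1 // => i _; rewrite rmorph0 mul0r. Qed.

Lemma xspanD n a b : xspan n a -> xspan n b -> xspan n (a + b).
Proof.
move=> [c ->] [d ->]; exists (fun i => c i + d i); rewrite -big_split /=.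
by apply: eq_bigr => i _; rewrite rmorphD mulrDl.
Qed.

Lemma xspanZ n c a : xspan n a -> xspan n (iota c * a).
Proof.
move=> [d ->]; exists (fun i => c * d i); rewrite mulr_sumr.
by apply: eq_bigr => i _; rewrite rmorphM mulrA.
Qed.

Lemma xspan_sum n (T : eqType) (r : seq T) (G : T -> L) :
  (forall i, i \in r -> xspan n (G i)) -> xspan n (\sum_(i <- r) G i).
Proof.
move=> spanG; rewrite big_seq; elim/big_ind: _ => //.
- exact: xspan0.
- by move=> a b; exact: xspanD.
Qed.

Lemma xspan_mulr n n' b a :
  (forall i : 'I_(m ^ n), xspan n' (xpath i * b)) -> xspan n a -> xspan n' (a * b).
Proof.
move=> spanb [c ->]; rewrite mulr_suml; apply: xspan_sum => i _.
by rewrite -mulrA; exact: xspanZ.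
Qed.

Lemma xspan_mull n n' b a :
  (forall i : 'I_(m ^ n), xspan n' (b * xpath i)) -> xspan n a -> xspan n' (b * a).
Proof.
move=> spanb [c ->]; rewrite mulr_sumr; apply: xspan_sum => i _.
by rewrite mulrA -iota_comm -mulrA; exact: xspanZ.
Qed.

Lemma xspan_mulr_x n k a : xspan n a -> xspan n.+1 (a * x k).
Proof. by apply: xspan_mulr => i; rewrite -xpathS; exact: xspan_xpath. Qed.

(** Monomials grow on the right, so a letter arriving on the left is handled by induction: the last
    letter is split off and then put back. *)
Lemma xspan_mull_x n k a : xspan n a -> xspan n.+1 (x k * a).
Proof.
elim: n a => [|n IH] a; apply: xspan_mull => i.
  have -> : x k * xpath i = xpath i * x k by rewrite mulr1 mul1r.
  by apply: xspan_mulr_x; exact: xspan_xpath.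
rewrite -[i]pow_unindexK xpathS mulrA; apply/xspan_mulr_x/IH.
exact: xspan_xpath.
Qed.

Lemma xspan_mull_y n k a : xspan n.+1 a -> xspan n (y k * a).
Proof.
elim: n a => [|n IH] a; apply: xspan_mull => i;
  rewrite -[i]pow_unindexK xpathS mulrA.
  (* At length one, [y_k x_l] is a scalar, that is, a multiple of the empty monomial. *)
  rewrite mulr1 yx -(rmorph_nat iota) -[iota _]mulr1; apply: xspanZ.
  exact: (xspan_xpath (ord0 : 'I_(m ^ 0))).
by apply/xspan_mulr_x/IH; exact: xspan_xpath.
Qed.

Definition leavitt_letter (g : 'I_m + 'I_m) : L :=
  match g with inl k => x k | inr k => y k end.

(** The letters of [w] act from its right end, each shifting the length by its degree. The reserve
    of [size w] letters ensures that no [y] meets an empty monomial. *)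
Lemma xspan_word (w : seq ('I_m + 'I_m)) n a :
    xspan (n + size w) a ->
  exists n', [/\ (n <= n')%N, xspan n' ((\prod_(g <- w) leavitt_letter g) * a) &
    n'%:Z = (n + size w)%:Z + \sum_(g <- w) (if g is inl _ then 1 else - 1)].
Proof.
elim: w n => [|g w IH] n spana.
  by exists n; rewrite !big_nil mul1r addr0; rewrite addn0 in spana *.
(* The bound is raised to [n.+1] for the tail, so the tail leaves a length above [n], hence a
   positive one if the head is a [y]. *)
rewrite /= addnS -addSn in spana *.
have [n' [lt_nn' span_n' n'E]] := IH _ spana.
rewrite !big_cons -mulrA addrCA -n'E; case: g => k /=.
  by exists n'.+1; split; [rewrite ltnW ?leqW | exact: xspan_mull_x | rewrite intS].
case: n' => // n' in lt_nn' span_n' n'E *; exists n'.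
by split=> //; [exact: xspan_mull_y | rewrite intS addKr].
Qed.

Lemma xspan_mx_leavitt n a :
  (forall i : 'I_(m ^ n), xspan n (a * xpath i)) -> exists A : 'M_(m ^ n), a = mx_leavitt A.
Proof.
(* The coordinates of [a * xpath j] form column [j], whence the exchanged indices. *)
move=> /choice[c cE]; exists (\matrix_(i, j) c j i).
by apply: mx_leavitt_of_xpath => j; rewrite cE; apply: eq_bigr => i _; rewrite mxE.
Qed.

End LeavittFamily.

(** * Nontriviality of the Leavitt algebra for [m > 0] *)

Section ShiftAction.
Variables (F : fieldType) (m : nat).
Hypothesis m_gt0 : (0 < m)%N.
Implicit Types (f : nat -> F) (n : nat) (w : seq ('I_m + 'I_m)).
Implicit Types p q : leavitt_free F m.

(** The letter [x_k] spreads a sequence over the residue class of [k] modulo [m], and [y_k] reads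
    that class back. *)
Definition act_letter (g : 'I_m + 'I_m) f n : F :=
  match g with
  | inl k => if (n %% m)%N == k then f (n %/ m)%N else 0
  | inr k => f (n * m + k)%N
  end.

Definition act_word w f : nat -> F := foldr act_letter f w.

Definition act p f n : F := mmap idfun (fun w : leavitt_word m => act_word w f n) p.

Lemma act_word_sum w (T : Type) (r : seq T) (c : T -> F) (h : T -> nat -> F) n :
  act_word w (fun i => \sum_(t <- r) c t * h t i) n =
  \sum_(t <- r) c t * act_word w (h t) n.
Proof.
elim: w n => [|[k|k] w IH] n //=.
by case: ifP => _; rewrite ?IH // big1 // => t _; rewrite mulr0.
Qed.

Lemma act_word0 w n : act_word w (fun=> 0) n = 0.
Proof. by elim: w n => [|[k|k] w IH] n //=; rewrite IH if_same. Qed.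

Lemma act0 f n : act 0 f n = 0.
Proof. exact: raddf0. Qed.

Lemma actB p q f n : act (p - q) f n = act p f n - act q f n.
Proof. exact: raddfB. Qed.

Lemma actM p q f n : act (p * q) f n = act p (act q f) n.
Proof.
rewrite /act malgME raddf_sum [RHS]mmapE; apply: eq_bigr => v _.
rewrite raddf_sum /=.
have -> : (fun n' => mmap idfun (fun w : leavitt_word m => act_word w f n') q) =
  (fun n' => \sum_(w <- msupp q) q@_w * act_word w f n').
  by apply/funext => n'; rewrite mmapE.
rewrite act_word_sum mulr_sumr; apply: eq_bigr => w _.
by rewrite mmapU /= fmM /act_word foldr_cat mulrA.
Qed.

Lemma act1 f n : act 1 f n = f n.
Proof. by rewrite /act mmapU /= fm1 mul1r. Qed.

Lemma act_gen g f n : act (free_gen F g) f n = act_letter g f n.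
Proof. by rewrite /act mmapU /= fmuE mul1r. Qed.

(** The relations hold because the residue classes modulo [m] partition the natural numbers and
    [n |-> n * m + k] enumerates class [k]. *)
Lemma act_relator p f n : leavitt_relator p -> act p f n = 0.
Proof.
case=> [k l|]; rewrite actB.
  rewrite actM act_gen /= act_gen /= modnMDl divnMDl // modn_small // divn_small // addn0.
  case: eqP => [/val_inj <-|ne_kl]; first by rewrite eqxx act1 subrr.
  by rewrite (introF eqP) ?act0 ?subr0 // => e; rewrite e in ne_kl.
rewrite act1 /act raddf_sum /=.
transitivity (\sum_k act (gen_x F k * gen_y F k) f n - f n) => //.
(* Only the letter [n %% m] contributes to the sum at [n], and Euclidean division returns [f n]. *)
pose r : 'I_m := Ordinal (ltn_pmod n m_gt0).
rewrite (bigD1 r) //= big1 => [|k ne_kr]; rewrite actM act_gen /= ?act_gen /=.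
  by rewrite eqxx -divn_eq addr0 subrr.
by rewrite (_ : _ == _ = false) //; apply: contra_neqF ne_kr => /eqP e; apply: val_inj.
Qed.

Lemma leavitt_nontrivial : (1 : leavitt F m) <> 0.
Proof.
move=> e.
have : gen_ideal (@leavitt_relator F m) (1 - 0).
  by apply/qpi_eq; rewrite raddf0; exact: e.
(* The sequence stays quantified: in a product the left factor acts on the sequence produced by the
   right one. *)
have act_ideal p : gen_ideal (@leavitt_relator F m) p -> forall f n, act p f n = 0.
  elim=> {p} [|p rel_p|p q _ IHp _ IHq|p q _ IHq|p q _ IHp] f n.
  - exact: act0.
  - exact: act_relator.
  - by rewrite actB IHp IHq subrr.
  - rewrite actM (_ : act q f = fun=> 0); last exact/funext.
    by rewrite /act mmapE big1 // => w _; rewrite act_word0 mulr0.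
  - by rewrite actM IHp.
move=> /act_ideal/(_ (fun=> 1) 0%N)/eqP.
by rewrite subr0 act1 oner_eq0.
Qed.

End ShiftAction.

(** * The embedding of the limit and its image in degree zero *)

Section LeavittDegreeZero.
Variables (F : fieldType) (m : nat).
Local Notation L := (leavitt F m).
Local Notation lpi := (@leavitt_pi F m).
Implicit Types (a b : L) (k l : 'I_m) (c : F).

Definition leavitt_const c : L := c *: (1 : L).

Lemma leavitt_constB : zmod_morphism leavitt_const.
Proof. by move=> c d; exact: scalerBl. Qed.
HB.instance Definition _ :=
  GRing.isZmodMorphism.Build F L leavitt_const leavitt_constB.

Lemma leavitt_const_mull c a : leavitt_const c * a = c *: a.
Proof. by rewrite -[in RHS](mul1r a); symmetry; exact: qscaleAl. Qed.

Lemma leavitt_const_mulr c a : a * leavitt_const c = c *: a.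
Proof. by rewrite -[in RHS](mulr1 a); symmetry; exact: qscaleAr. Qed.

Lemma leavitt_constM : monoid_morphism leavitt_const.
Proof.
by split=> [|c d]; [exact: scale1r | rewrite leavitt_const_mull scalerA].
Qed.
HB.instance Definition _ :=
  GRing.isMonoidMorphism.Build F L leavitt_const leavitt_constM.

Lemma leavitt_const_comm c a : leavitt_const c * a = a * leavitt_const c.
Proof. by rewrite leavitt_const_mull leavitt_const_mulr. Qed.

Definition leavitt_x k : L := lpi (gen_x F k).
Definition leavitt_y k : L := lpi (gen_y F k).

Lemma leavitt_yx k l : leavitt_y k * leavitt_x l = (k == l)%:R.
Proof.
rewrite /leavitt_y /leavitt_x /leavitt_pi -rmorphM.
rewrite -[RHS](rmorph_nat (@qpi _ _ (@leavitt_relator F m))).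
by apply/qpi_eq/gen_idealS; exact: relator_yx.
Qed.

Lemma leavitt_xy : \sum_k leavitt_x k * leavitt_y k = 1.
Proof.
transitivity (lpi (\sum_k gen_x F k * gen_y F k)).
  rewrite /leavitt_pi rmorph_sum; apply: eq_bigr => k _.
  by rewrite rmorphM.
by apply/qpi_eq/gen_idealS; exact: relator_xy.
Qed.

Local Notation letter := (leavitt_letter leavitt_x leavitt_y).

Lemma leavitt_piU (w : leavitt_word m) :
  lpi << w >> = \prod_(g <- (w : seq _)) letter g.
Proof.
case: w => w /=; elim: w => [|g w IH].
  by rewrite big_nil -fmoneE; exact: (rmorph1 (@qpi _ _ (@leavitt_relator F m))).
rewrite big_cons -IH.
have -> : << FMonom (g :: w) >> = free_gen F g * << FMonom w >> :> leavitt_free F m.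
  rewrite [RHS]malgM_def fgmulUU mulr1; congr << _ >>.
  by rewrite -[RHS]fmK fmM fmuE.
rewrite /leavitt_pi rmorphM; congr (_ * _).
by case: g.
Qed.

Lemma leavitt_piE (p : leavitt_free F m) :
  lpi p = \sum_(w <- msupp p)
    leavitt_const p@_w * \prod_(g <- (w : seq _)) letter g.
Proof.
rewrite {1}[p]monalgE /leavitt_pi rmorph_sum; apply: eq_bigr => w _.
rewrite -leavitt_piU leavitt_const_mull /leavitt_pi -linearZ; congr (qpi _ _).
by rewrite malgZ_def /fgscale msuppU1 big_seq_fset1 mcoeffUU mulr1.
Qed.

Local Notation limit_mx_leavitt := (limit_mx_leavitt leavitt_const leavitt_x leavitt_y).

Lemma leavitt_compM d e a b :
  a \in leavitt_comp d -> b \in leavitt_comp e -> a * b \in leavitt_comp (d + e).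
Proof.
move=> /asboolP[p hp ->] /asboolP[q hq ->]; apply/asboolP.
by exists (p * q); [exact: homogM | rewrite /leavitt_pi rmorphM].
Qed.

Lemma homog_gen (g : 'I_m + 'I_m) :
  homog (if g is inl _ then 1 else - 1) (free_gen F g : leavitt_free F m).
Proof.
move=> w; rewrite msuppU1 in_fset1 => /eqP->.
by rewrite /word_deg fmuE big_seq1.
Qed.

Lemma xpath_deg t (i : 'I_(m ^ t)) : xpath leavitt_x i \in @leavitt_comp F m t%:Z.
Proof.
elim: t i => [|t IH] i; first exact: (rpred1 (@leavitt0_pred F m)).
rewrite -[i]pow_unindexK xpathS -addn1 PoszD; apply: leavitt_compM => //.
by apply/asboolP; exists (gen_x F (pow_unindex i).1) => //; exact: homog_gen.
Qed.

Lemma ypath_deg t (i : 'I_(m ^ t)) : ypath leavitt_y i \in @leavitt_comp F m (- t%:Z).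
Proof.
elim: t i => [|t IH] i; first exact: (rpred1 (@leavitt0_pred F m)).
rewrite -[i]pow_unindexK ypathS -add1n PoszD opprD; apply: leavitt_compM => //.
by apply/asboolP; exists (gen_y F (pow_unindex i).1) => //; exact: homog_gen.
Qed.

(** The degrees [t] and [- t] of [xpath i] and [ypath j] cancel. *)
Lemma limit_mx_leavitt_deg0 z : limit_mx_leavitt z \in @leavitt0_pred F m.
Proof.
apply: rpred_sum => i _; apply: rpred_sum => j _.
rewrite leavitt_const_mull; apply: rpredZ.
by have := leavitt_compM (xpath_deg i) (ypath_deg j); rewrite subrr.
Qed.

Lemma limit_mx_leavitt_surj a : a \in @leavitt0_pred F m -> exists z, limit_mx_leavitt z = a.
Proof.
case/leavitt0P=> p hp ->.
(* No word of [p] is longer than [n], so a single matrix size serves all of them. *)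
pose n := \max_(w <- msupp p) size (w : seq _).
have [|A ->] := @xspan_mx_leavitt _ _ leavitt_const m leavitt_x leavitt_y
    leavitt_xy n (lpi p); last first.
  by exists (limit_in A); rewrite limit_mx_leavittE //; exact: leavitt_xy.
move=> i; rewrite leavitt_piE mulr_suml; apply: xspan_sum => w w_p.
rewrite -mulrA; apply: xspanZ.
have le_wn : (size (w : seq _) <= n)%N by exact: (leq_bigmax_seq w).
(* The lower bound [n - size w] makes the starting length exactly [n]; degree zero then makes the
   final length [n] again. *)
have := @xspan_word _ _ leavitt_const m leavitt_x leavitt_y leavitt_const_comm
   leavitt_yx w (n - size (w : seq _)) (xpath leavitt_x i).
rewrite subnK // => /(_ (xspan_xpath _ _ i))[n' [_ span_n']].
by rewrite -/(word_deg w) (hp w w_p) addr0 => -[e]; rewrite e in span_n'.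
Qed.

Lemma matrix_limit_trivial : m = 0 -> forall z w : matrix_limit F m, z = w.
Proof.
move=> m0 z w; have [t [A [B [-> ->]]]] := limit_common2 z w.
(* Stage 0 has size [0 ^ 0 = 1], so equality is checked one stage later, where the matrices are
   empty. *)
rewrite -(limit_in_transition (leqnSn t) A) -(limit_in_transition (leqnSn t) B).
by congr limit_in; apply/matrixP => -[i lt_i]; exfalso; rewrite m0 exp0n in lt_i.
Qed.

Lemma leavitt_limit_mx_leavitt_inj : injective limit_mx_leavitt.
Proof.
have [m0|m_gt0] := posnP m; first by move=> z w _; exact: matrix_limit_trivial.
apply: limit_mx_leavitt_inj; first exact: leavitt_const_comm.
- exact: leavitt_yx.
- exact: leavitt_xy.
exact: leavitt_nontrivial.
Qed.

End LeavittDegreeZero.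

Theorem theorem5p3 (F : fieldType) (m : nat) :
  exists f : {linear leavitt0 F m -> matrix_limit F m},
    monoid_morphism f /\ bijective f.
Proof.
pose Phi := limit_mx_leavitt (@leavitt_const F m) (@leavitt_x F m) (@leavitt_y F m).
have PhiD : {morph Phi : z w / z + w} by apply: limit_mx_leavittD; exact: leavitt_xy.
have PhiM : {morph Phi : z w / z * w}.
  by apply: limit_mx_leavittM; [exact: leavitt_const_comm | exact: leavitt_yx | exact: leavitt_xy].
have PhiZ c : {morph Phi : z / c *: z}.
  by move=> z; rewrite /Phi limit_mx_leavittZ ?leavitt_const_mull //; exact: leavitt_xy.
have Phi1 : Phi 1 = 1 by apply: limit_mx_leavitt1; exact: leavitt_xy.
have Phi_inj : injective Phi by exact: leavitt_limit_mx_leavitt_inj.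
(* The isomorphism is the inverse of [Phi]: choice extracts it from surjectivity, and injectivity of
   [Phi] transfers the algebra laws to it. *)
have /choice[f fK] (a : leavitt0 F m) : exists z, Phi z = val a.
  exact: limit_mx_leavitt_surj (valP a).
have f_linear : linear f.
  by move=> c a b; apply: Phi_inj; rewrite PhiD PhiZ !fK.
have f_monoid : monoid_morphism f.
  by split=> [|a b]; apply: Phi_inj; rewrite ?PhiM !fK ?Phi1.
pose f' := GRing.isLinear.Build F (leavitt0 F m) (matrix_limit F m) *:%R f f_linear.
pose fL : {linear leavitt0 F m -> matrix_limit F m} := HB.pack f f'.
exists fL; split=> //; exists (fun z => Leavitt0 (limit_mx_leavitt_deg0 z)) => [a|z].
  by apply: val_inj; exact: fK.
by apply: Phi_inj; exact: fK.
Qed.
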